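(* Let $k, t, p \ge 1$ be integers with $t\le k$, and let $n=kp$. Define constant vectors $R=tpJ_{n-k,1}$ and $S=t(p-1)J_{n,1}$ (i.e., every entry of $R$ equals $tp$ and every entry of $S$ equals $t(p-1)$), and let $A$ be an $(n-k)\times n$ $(0,1)$-matrix with row sum vector $R$ and column sum vector $S$. Then the $n\times n$ matrix \[ V=\frac{1}{tp} \left[ \begin{array}{c} \begin{array}{cccc} tI_k & tI_k& \cdots & tI_k \end{array} \\ \hline A \end{array} \right], \] whose first $k$ rows consist of the block $tI_k$ repeated $p$ times side by side and whose last $n-k$ rows form the matrix $A$, is an RCDS doubly stochastic matrix.
   Context: A diagonal of an $n\times n$ matrix $X$ is the set of entries $x_{1,k_1},\ldots,x_{n,k_n}$ for a permutation $(k_1,\ldots,k_n)$ of $\{1,\ldots,n\}$; its sum is a diagonal sum. $\xi(X)$ denotes the set of positions where $X$ has zeros. An RCDS (restricted constant diagonal sum) doubly stochastic matrix is a doubly stochastic matrix $X$ (nonnegative, all row and column sums equal to 1) such that all diagonals of $X$ that avoid the positions in $\xi(X)$ have the same sum. $J_{m,1}$ denotes the $m\times 1$ all-ones vector and $I_k$ the $k\times k$ identity matrix. *)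

(* Defs.v *)
From mathcomp Require Export all_boot all_order all_fingroup all_algebra.

Set Implicit Arguments.
Unset Strict Implicit.
Unset Printing Implicit Defensive.

Import Order.TTheory GRing.Theory Num.Theory.
Local Open Scope ring_scope.

Section Matrices.
Variable R : realFieldType.

Definition zero_positions n (X : 'M[R]_n) : {set 'I_n * 'I_n} :=
  [set ij | X ij.1 ij.2 == 0].

Definition diagonal_positions n (s : 'S_n) : {set 'I_n * 'I_n} :=
  [set (i, s i) | i : 'I_n].

Definition diagonal_sum n (X : 'M[R]_n) (s : 'S_n) : R := \sum_i X i (s i).

Definition row_sum_vector m n (X : 'M[R]_(m, n)) : 'cV[R]_m :=
  \col_i \sum_j X i j.

Definition col_sum_vector m n (X : 'M[R]_(m, n)) : 'cV[R]_n :=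
  \col_j \sum_i X i j.

Definition doubly_stochastic n (X : 'M[R]_n) : Prop :=
  [/\ forall i j, 0 <= X i j,
      forall i, \sum_j X i j = 1
    & forall j, \sum_i X i j = 1].

Definition RCDS n (X : 'M[R]_n) : Prop :=
  forall s1 s2 : 'S_n,
    [disjoint diagonal_positions s1 & zero_positions X] ->
    [disjoint diagonal_positions s2 & zero_positions X] ->
    diagonal_sum X s1 = diagonal_sum X s2.

Definition RCDS_doubly_stochastic n (X : 'M[R]_n) : Prop :=
  doubly_stochastic X /\ RCDS X.

Definition zero_one_matrix m n (X : 'M[R]_(m, n)) : Prop :=
  forall i j, X i j = 0 \/ X i j = 1.

Definition J m n : 'M[R]_(m, n) := const_mx 1.

Lemma sum_const_ord (p k : nat) : (\sum_(j < p) k = k * p)%N.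
Proof. by rewrite sum_nat_const card_ord mulnC. Qed.

Definition top_block (k t p : nat) : 'M[R]_(k, k * p) :=
  castmx (erefl k, sum_const_ord p k) (\mxrow_(j < p) (t%:R *: 1%:M : 'M[R]_k)).

(* The cast only identifies k + (kp - k) with kp; it needs p > 0. *)
Definition V_matrix (k t p : nat) (p_gt0 : (0 < p)%N)
    (A : 'M[R]_(k * p - k, k * p)) : 'M[R]_(k * p) :=
  (t * p)%:R^-1 *:
    castmx (subnKC (leq_pmulr k p_gt0), erefl (k * p)%N)
      (col_mx (top_block k t p) A).

End Matrices.

Arguments V_matrix {R k} t {p} p_gt0 A.

(* Main.v *)
(* Each row of V has a single nonzero value, so every diagonal avoiding the
   zeros of V picks the same value in a given row, whatever the diagonal. *)
Require Import Defs.

Set Implicit Arguments.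
Unset Strict Implicit.
Unset Printing Implicit Defensive.

Import Order.TTheory GRing.Theory Num.Theory.
Local Open Scope ring_scope.

(** Before division by [tp], every line of the stacked matrix sums to [tp]: a row of the top block
    meets one [t] in each of its [p] blocks ([top_block_row_sum]), and a column meets one [t] there
    ([top_block_col_sum]) plus [t(p-1)] in [A]. Nonzero entries are [t] in the first [k] rows and 1
    below, so [RCDS_of_row_values] applies. *)

Section CastmxSums.
Variables (R : nmodType) (m n m' n' : nat) (eq_mn : (m = m') * (n = n')).

Lemma row_sum_castmx (X : 'M[R]_(m, n)) i :
  \sum_j castmx eq_mn X i j = \sum_j X (cast_ord (esym eq_mn.1) i) j.
Proof.
by case: eq_mn i => eq_m eq_n; case: _ / eq_m; case: _ / eq_n => i;
  rewrite castmx_id cast_ord_id.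
Qed.

Lemma col_sum_castmx (X : 'M[R]_(m, n)) j :
  \sum_i castmx eq_mn X i j = \sum_i X i (cast_ord (esym eq_mn.2) j).
Proof.
by case: eq_mn j => eq_m eq_n; case: _ / eq_m; case: _ / eq_n => j;
  rewrite castmx_id cast_ord_id.
Qed.

End CastmxSums.

(** A diagonal meets each row once; if it avoids the zeros it picks [c i] in row [i], so its sum is
    the sum of all [c i]. *)
Lemma RCDS_of_row_values (R : realFieldType) n (X : 'M[R]_n) (c : 'I_n -> R) :
  (forall i j, X i j = 0 \/ X i j = c i) -> RCDS X.
Proof.
move=> Xc; suff diagE s :
    [disjoint diagonal_positions s & zero_positions X] ->
    diagonal_sum X s = \sum_i c i.
  by move=> s1 s2 /diagE -> /diagE ->.
move=> /disjointFr s_avoids; apply: eq_bigr => i _.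
have [Xi0|//] := Xc i (s i).
have := s_avoids (i, s i) (imset_f _ isT).
by rewrite inE /= Xi0 eqxx.
Qed.

Section TopBlock.
Variables (R : realFieldType) (k t p : nat).

Lemma top_block_values i j :
  top_block R k t p i j = 0 \/ top_block R k t p i j = t%:R.
Proof.
rewrite castmxE !mxE; case: (_ == _); last by left; rewrite mulr0.
by right; rewrite mulr1.
Qed.

Lemma top_block_row_sum i : \sum_j top_block R k t p i j = (t * p)%:R.
Proof.
rewrite row_sum_castmx cast_ord_id.
(* Row sums are entries of the product with the all-ones column, which can be computed block by
   block. *)
have /matrixP/(_ i ord0) := mul_mxrow_mxcol
  (fun _ : 'I_p => t%:R *: 1%:M : 'M[R]_k) (fun _ => const_mx 1 : 'M[R]_(k, 1)).
rewrite mxcol_const mxE summxE => rowE; apply: etrans (etrans rowE _).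
  by apply: eq_bigr => j _; rewrite [const_mx _ _ _]mxE mulr1.
under eq_bigr do rewrite -scalemxAl mul1mx !mxE mulr1.
by rewrite sumr_const card_ord natrM mulr_natr.
Qed.

Lemma top_block_col_sum j : \sum_i top_block R k t p i j = t%:R.
Proof.
have sum_delta (l : 'I_k) : \sum_i (i == l)%:R = 1 :> R.
  by rewrite (bigD1 l) //= eqxx big1 ?addr0 // => i /negPf ->.
(* A column lies in a single block, where it is [t] times a unit vector. *)
rewrite col_sum_castmx; under eq_bigr do rewrite !mxE.
by rewrite -mulr_sumr sum_delta mulr1.
Qed.

End TopBlock.

Theorem theorem2p2 (R : realFieldType) (k t p : nat)
    (k_gt0 : (0 < k)%N) (t_gt0 : (0 < t)%N) (p_gt0 : (0 < p)%N)
    (le_tk : (t <= k)%N)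
    (A : 'M[R]_(k * p - k, k * p))
    (A01 : zero_one_matrix A)
    (A_rows : row_sum_vector A = (t * p)%:R *: J R (k * p - k) 1)
    (A_cols : col_sum_vector A = (t * (p - 1))%:R *: J R (k * p) 1) :
  RCDS_doubly_stochastic (V_matrix t p_gt0 A).
Proof.
have tp_neq0 : (t * p)%:R != 0 :> R by rewrite pnatr_eq0 -lt0n muln_gt0 t_gt0.
(* [W] is [V] without the cast and the scaling, which are handled only at the end. *)
set W := col_mx (top_block R k t p) A.
have W_ge0 i j : 0 <= W i j.
  case: (split_ordP i) => i' ->; rewrite (col_mxEu, col_mxEd).
    by case: (top_block_values R t i' j) => ->.
  by case: (A01 i' j) => ->.
have W_rows i : \sum_j W i j = (t * p)%:R.
  case: (split_ordP i) => i' ->; under eq_bigr do rewrite (col_mxEu, col_mxEd).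
    exact: top_block_row_sum.
  by move/colP/(_ i'): A_rows; rewrite !mxE mulr1.
have W_cols j : \sum_i W i j = (t * p)%:R.
  rewrite big_split_ord /=; under eq_bigr do rewrite col_mxEu.
  rewrite top_block_col_sum; under eq_bigr do rewrite col_mxEd.
  move/colP/(_ j): A_cols; rewrite !mxE mulr1 => ->.
  (* [t + t(p-1) = tp]; the truncated [p - 1] is harmless since [p > 0]. *)
  by rewrite -natrD -mulnS subn1 prednK.
have W_values i j : W i j = 0 \/ W i j = if (i < k)%N then t%:R else 1.
  case: (split_ordP i) => i' ->; rewrite (col_mxEu, col_mxEd) /=.
    exact: top_block_values.
  exact: A01.
split.
  split=> [i j|i|j].
  - by rewrite mxE castmxE mulr_ge0 // invr_ge0 ler0n.
  - under eq_bigr do rewrite mxE.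
    by rewrite -mulr_sumr row_sum_castmx W_rows mulVf.
  - under eq_bigr do rewrite mxE.
    by rewrite -mulr_sumr col_sum_castmx W_cols mulVf.
(* Casting an ordinal keeps its value, so the test [i < k] is the same for [V] as for [W]. *)
apply: (@RCDS_of_row_values _ _ _
  (fun i => (t * p)%:R^-1 * if (i < k)%N then t%:R else 1)) => i j.
rewrite mxE castmxE.
case: (W_values (cast_ord (esym (subnKC (leq_pmulr k p_gt0))) i)
  (cast_ord (esym (erefl (k * p)%N)) j)) => ->; last by right.
by left; rewrite mulr0.
Qed.
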